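(* Let $\mathcal{L}$ be a countable many-sorted first-order signature and $(\mathcal{K},\mu)$ a measured model class over $\mathcal{L}$. The map $\bar\mu:\mathbb{B}_{\mathcal{K}}\to[0,1]$, $\bar\mu([\varphi])=\mu([\![\varphi]\!]_{\mathcal{K}})$, is a (well-defined) finitely additive probability measure on the Boolean algebra $\mathbb{B}_{\mathcal{K}}$: $\bar\mu(\top)=1$, $\bar\mu(\bot)=0$, and if $a,b\in\mathbb{B}_{\mathcal{K}}$ satisfy $a\wedge b=\bot$, then $\bar\mu(a\vee b)=\bar\mu(a)+\bar\mu(b)$.
   Context: For a class $\mathcal{K}$ of $\mathcal{L}$-structures and an $\mathcal{L}$-sentence $\varphi$, $[\![\varphi]\!]_{\mathcal{K}}:=\{\mathfrak{M}\in\mathcal{K}:\mathfrak{M}\models\varphi\}$. A measured model class is a pair $(\mathcal{K},\mu)$ where $\mu$ is a probability measure on a $\sigma$-algebra on $\mathcal{K}$ containing all sets $[\![\varphi]\!]_{\mathcal{K}}$. Write $\varphi\equiv_{\mathcal{K}}\psi$ iff $[\![\varphi]\!]_{\mathcal{K}}=[\![\psi]\!]_{\mathcal{K}}$; $\mathbb{B}_{\mathcal{K}}:=\operatorname{Sent}(\mathcal{L})/\equiv_{\mathcal{K}}$ with Boolean operations induced by $\neg,\wedge,\vee$. *)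

(* Defs.v *)
From HB Require Import structures.
From mathcomp Require Import all_boot all_order all_algebra.
From mathcomp Require Import generic_quotient.
From mathcomp Require Import all_classical all_reals all_analysis.

Set Implicit Arguments.
Unset Strict Implicit.
Unset Printing Implicit Defensive.

Import Order.TTheory GRing.Theory Num.Theory.

Local Open Scope quotient_scope.
Local Open Scope classical_set_scope.
Local Open Scope ring_scope.

(* Constants are the function symbols of arity 0. *)
Record signature := Signature {
  sort : Type;
  fsym : Type;
  farity : fsym -> nat;
  fdom : forall f, 'I_(farity f) -> sort;
  fcod : fsym -> sort;
  rsym : Type;
  rarity : rsym -> nat;
  rdom : forall r, 'I_(rarity r) -> sort }.

Definition countable_signature (L : signature) : Prop :=
  [/\ countable [set: sort L], countable [set: fsym L]
    & countable [set: rsym L]].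

(* Well-sorted de Bruijn variables: [G] lists the sorts of the variables in
   scope, the most recently bound one first. *)
Inductive var (L : signature) : seq (sort L) -> sort L -> Type :=
| VarZ s G : var (s :: G) s
| VarS s t G : var G t -> var (s :: G) t.

Inductive term (L : signature) (G : seq (sort L)) : sort L -> Type :=
| TVar s : var G s -> term G s
| TApp (f : fsym L) : (forall i, term G (fdom (f := f) i)) -> term G (fcod f).

Inductive formula (L : signature) : seq (sort L) -> Type :=
| FEq G s : term G s -> term G s -> formula G
| FRel G (r : rsym L) : (forall i, term G (rdom (r := r) i)) -> formula G
| FBot G : formula G
| FNot G : formula G -> formula G
| FAnd G : formula G -> formula G -> formula G
| FOr G : formula G -> formula G -> formula G
| FImp G : formula G -> formula G -> formula G
| FEx G s : formula (s :: G) -> formula G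
| FAll G s : formula (s :: G) -> formula G.

Arguments FBot {L G}.

Definition sentence (L : signature) : Type := @formula L [::].

HB.instance Definition _ (L : signature) := gen_eqMixin (sentence L).
HB.instance Definition _ (L : signature) := gen_choiceMixin (sentence L).

(* Carriers may be empty; the usual convention that they are nonempty amounts
   to a restriction on the class of structures considered. *)
Record structure (L : signature) := Structure {
  carrier :> sort L -> Type;
  finterp : forall f : fsym L,
    (forall i, carrier (fdom (f := f) i)) -> carrier (fcod f);
  rinterp : forall r : rsym L,
    (forall i, carrier (rdom (r := r) i)) -> Prop }.

Section Semantics.
Variables (L : signature) (M : structure L).

Definition valuation (G : seq (sort L)) := forall s, var G s -> M s.

Definition val_nil : valuation [::] :=
  fun s (x : var [::] s) =>
    match x in var G t return (if G is [::] then M t else unit) with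
    | VarZ _ _ => tt
    | VarS _ _ _ _ => tt
    end.

Definition val_cons G s (a : M s) (v : valuation G) : valuation (s :: G) :=
  fun t (x : var (s :: G) t) =>
    match x in var G' t'
      return (if G' is s' :: G0 then M s' -> valuation G0 -> M t' else unit)
    with
    | VarZ _ _ => fun a _ => a
    | VarS _ t0 _ y => fun _ v => v t0 y
    end a v.

Fixpoint teval G (v : valuation G) s (t : term G s) : M s :=
  match t with
  | TVar _ x => v _ x
  | TApp f ts => finterp (fun i => teval v (ts i))
  end.

Fixpoint sat G (phi : formula G) : valuation G -> Prop :=
  match phi with
  | FEq _ _ t1 t2 => fun v => teval v t1 = teval v t2
  | FRel _ r ts => fun v => rinterp (r := r) (fun i => teval v (ts i))
  | FBot _ => fun=> False
  | FNot _ p => fun v => ~ sat p v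
  | FAnd _ p q => fun v => sat p v /\ sat q v
  | FOr _ p q => fun v => sat p v \/ sat q v
  | FImp _ p q => fun v => sat p v -> sat q v
  | FEx _ _ p => fun v => exists a, sat p (val_cons a v)
  | FAll _ _ p => fun v => forall a, sat p (val_cons a v)
  end.

Definition models (phi : sentence L) : Prop := sat phi val_nil.

End Semantics.

Definition ext (L : signature) (K : set (structure L)) (phi : sentence L) :
    set (set_type K) :=
  [set M | models (set_val M) phi].

Arguments ext {L} K phi.

Section SentenceAlgebra.
Variables (L : signature) (K : set (structure L)).

Definition sent_equiv : rel (sentence L) :=
  fun phi psi => `[< ext K phi = ext K psi >].

Fact sent_equiv_refl : reflexive sent_equiv.
Proof. by move=> phi; apply/asboolP. Qed.

Fact sent_equiv_sym : symmetric sent_equiv.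
Proof. by move=> phi psi; apply/asboolP/asboolP => ->. Qed.

Fact sent_equiv_trans : transitive sent_equiv.
Proof. by move=> b a c /asboolP ab /asboolP bc; apply/asboolP; rewrite ab. Qed.

Canonical sent_equiv_rel :=
  EquivRel sent_equiv sent_equiv_refl sent_equiv_sym sent_equiv_trans.

Definition sent_alg := {eq_quot sent_equiv_rel}.

HB.instance Definition _ := Choice.on sent_alg.

Definition cls (phi : sentence L) : sent_alg := \pi_sent_alg phi.

Lemma cls_eqP phi psi : cls phi = cls psi <-> ext K phi = ext K psi.
Proof.
by split=> [/eqquotP/asboolP|E]; [|apply/eqquotP/asboolP].
Qed.

Definition cls_ext (a : sent_alg) : set (set_type K) := ext K (repr a).

Lemma cls_extE phi : cls_ext (cls phi) = ext K phi.
Proof. by apply/cls_eqP; rewrite /cls reprK. Qed.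

Lemma cls_ext_inj : injective cls_ext.
Proof. by move=> a b /cls_eqP; rewrite /cls !reprK. Qed.

Definition sa_meet (a b : sent_alg) := cls (FAnd (repr a) (repr b)).
Definition sa_join (a b : sent_alg) := cls (FOr (repr a) (repr b)).
Definition sa_compl (a : sent_alg) := cls (FNot (repr a)).
Definition sa_bot := cls FBot.
Definition sa_top := cls (FNot FBot).
Definition sa_le (a b : sent_alg) := sa_meet a b == a.
Definition sa_lt (a b : sent_alg) := (b != a) && sa_le a b.

Lemma ext_sa_meet a b : cls_ext (sa_meet a b) = cls_ext a `&` cls_ext b.
Proof. by rewrite cls_extE. Qed.

Lemma ext_sa_join a b : cls_ext (sa_join a b) = cls_ext a `|` cls_ext b.
Proof. by rewrite cls_extE. Qed.

Lemma ext_sa_compl a : cls_ext (sa_compl a) = ~` cls_ext a.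
Proof. by rewrite cls_extE. Qed.

Lemma ext_sa_bot : cls_ext sa_bot = set0.
Proof. by rewrite cls_extE. Qed.

Lemma ext_sa_top : cls_ext sa_top = setT.
Proof. by rewrite cls_extE; apply/seteqP; split=> // M _; apply. Qed.

Let sa_extE :=
  (ext_sa_meet, ext_sa_join, ext_sa_compl, ext_sa_bot, ext_sa_top).

Fact sa_meetC : commutative sa_meet.
Proof. by move=> a b; apply: cls_ext_inj; rewrite !sa_extE setIC. Qed.

Fact sa_joinC : commutative sa_join.
Proof. by move=> a b; apply: cls_ext_inj; rewrite !sa_extE setUC. Qed.

Fact sa_meetA : associative sa_meet.
Proof. by move=> a b c; apply: cls_ext_inj; rewrite !sa_extE setIA. Qed.

Fact sa_joinA : associative sa_join.
Proof. by move=> a b c; apply: cls_ext_inj; rewrite !sa_extE setUA. Qed.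

Fact sa_joinKI b a : sa_meet a (sa_join a b) = a.
Proof. by apply: cls_ext_inj; rewrite !sa_extE setUC setKU. Qed.

Fact sa_meetKU b a : sa_join a (sa_meet a b) = a.
Proof. by apply: cls_ext_inj; rewrite !sa_extE setIC setKI. Qed.

Fact sa_meetUl : left_distributive sa_meet sa_join.
Proof. by move=> a b c; apply: cls_ext_inj; rewrite !sa_extE setIUl. Qed.

Fact sa_meetxx : idempotent_op sa_meet.
Proof. by move=> a; apply: cls_ext_inj; rewrite !sa_extE setIid. Qed.

Fact sa_display : Order.disp_t. Proof. exact: Order.Disp tt tt. Qed.

HB.instance Definition _ :=
  Order.isMeetJoinDistrLattice.Build sa_display sent_alg
    (fun _ _ => erefl) (fun _ _ => erefl) sa_meetC sa_joinC sa_meetA sa_joinA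
    sa_joinKI sa_meetKU sa_meetUl sa_meetxx.

Fact sa_le0x a : (sa_bot <= a)%O.
Proof. by apply/eqP/cls_ext_inj; rewrite !sa_extE set0I. Qed.

Fact sa_lex1 a : (a <= sa_top)%O.
Proof. by apply/eqP/cls_ext_inj; rewrite !sa_extE setIT. Qed.

HB.instance Definition _ := Order.hasBottom.Build sa_display sent_alg sa_le0x.
HB.instance Definition _ := Order.hasTop.Build sa_display sent_alg sa_lex1.

Fact sa_joinxC (a : sent_alg) : (a `|` sa_compl a)%O = \top%O.
Proof. by apply: cls_ext_inj; rewrite !sa_extE setUCr. Qed.

Fact sa_meetxC (a : sent_alg) : (a `&` sa_compl a)%O = \bot%O.
Proof. by apply: cls_ext_inj; rewrite !sa_extE setICr. Qed.

HB.instance Definition _ :=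
  Order.TBDistrLattice_hasComplement.Build sa_display sent_alg
    sa_joinxC sa_meetxC.

Lemma clsI phi psi : cls (FAnd phi psi) = (cls phi `&` cls psi)%O.
Proof. by apply: cls_ext_inj; rewrite ext_sa_meet !cls_extE. Qed.

Lemma clsU phi psi : cls (FOr phi psi) = (cls phi `|` cls psi)%O.
Proof. by apply: cls_ext_inj; rewrite ext_sa_join !cls_extE. Qed.

Lemma clsC phi : cls (FNot phi) = (~` cls phi)%O.
Proof. by apply: cls_ext_inj; rewrite ext_sa_compl !cls_extE. Qed.

End SentenceAlgebra.

Arguments sent_alg {L} K.
Arguments cls {L} K phi.

(* [set_type K] made into a pointed type, as [measurableType] requires. *)
Definition class_type (L : signature) (K : set (structure L))
  (K0 : K !=set0) : Type := set_type K.

Section ClassType.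
Variables (L : signature) (K : set (structure L)) (K0 : K !=set0).

HB.instance Definition _ := gen_eqMixin (class_type K0).
HB.instance Definition _ := gen_choiceMixin (class_type K0).
HB.instance Definition _ :=
  isPointed.Build (class_type K0)
    (SigSub (mem_set (projT2 (cid K0))) : class_type K0).

End ClassType.

(* Nonemptiness is no restriction, a probability measure on the empty class
   being impossible.  Since [mevents] is a sigma-algebra, it is exactly the
   family of measurable sets of [g_sigma_algebraType mevents]. *)
Record measured_class (L : signature) (R : realType) := MeasuredClass {
  mclass :> set (structure L);
  mclass_neq0 : mclass !=set0;
  mevents : set (set (class_type mclass_neq0));
  mevents_sigma : sigma_algebra [set: class_type mclass_neq0] mevents;
  mevents_ext : forall phi, mevents (ext mclass phi);
  mprob : probability (g_sigma_algebraType mevents) R }.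

Definition finitely_additive_probability (d : Order.disp_t)
    (B : ctbDistrLatticeType d) (R : realType) (m : B -> R) : Prop :=
  [/\ forall a, 0 <= m a <= 1,
      m \top%O = 1,
      m \bot%O = 0
    & forall a b, (a `&` b)%O = \bot%O -> m (a `|` b)%O = m a + m b].

(* Main.v *)
Require Import Defs.
From mathcomp Require Import all_boot all_order all_algebra.
From mathcomp Require Import all_classical all_reals all_analysis.

Local Open Scope ring_scope.

(** [cls_ext] is a Boolean homomorphism from the sentence algebra to subsets of the class, with
    values in the events by [measurable_cls_ext]. Pulling [mprob] back along it gives the required
    map, and each law is inherited from the measure through [ext_sa_top], [ext_sa_bot] and
    [ext_sa_join]. *)

Lemma measurable_cls_ext (L : signature) (R : realType)
    (K : measured_class L R) (a : sent_alg K) :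
  measurable (cls_ext a : set (g_sigma_algebraType (@mevents L R K))).
Proof. by apply: sub_sigma_algebra; exact: mevents_ext. Qed.

Lemma cls_repr (L : signature) (K : set (structure L)) (a : sent_alg K) :
  cls K (generic_quotient.repr a) = a.
Proof. by apply: cls_ext_inj; rewrite cls_extE. Qed.

(* The first conjunct says that the prescription [phi] |-> mu [[phi]]_K is
   well defined on the quotient, i.e. that it determines a unique function. *)
Theorem proposition2p20 (L : signature) (R : realType)
    (hL : countable_signature L) (K : measured_class L R) :
  exists mubar : sent_alg K -> R,
    unique (fun f : sent_alg K -> R =>
              forall phi : sentence L,
                (f (cls K phi))%:E = mprob K (ext K phi)) mubar /\
    finitely_additive_probability mubar.
Proof.
pose mu (a : sent_alg K) := mprob K (cls_ext a).
(* A probability is finite on events, so [fine] loses no information. *)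
have muE a : (fine (mu a))%:E = mu a.
  by rewrite fineK// fin_num_measure//; exact: measurable_cls_ext.
exists (fun a => fine (mu a)); split; first split=> [phi|f fE].
- by rewrite muE /mu cls_extE.
(* Each class is that of its representative, so the prescription fixes [f] everywhere. *)
- apply/funext => a; apply: EFin_inj.
  by rewrite muE -[in RHS](cls_repr _ _ a) fE.
split=> [a|||a b ab0].
- rewrite -!lee_fin muE measure_ge0/=.
  by apply: probability_le1; exact: measurable_cls_ext.
- by apply: EFin_inj; rewrite muE /mu ext_sa_top; exact: probability_setT.
- by apply: EFin_inj; rewrite muE /mu ext_sa_bot measure0.
- apply: EFin_inj; rewrite EFinD !muE /mu ext_sa_join.
  apply: measureU; [exact: measurable_cls_ext..|].
  (* The lattice meet is [sa_meet] by conversion, so [ab0] makes the extensions disjoint. *)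
  by rewrite -ext_sa_meet [sa_meet a b]ab0 ext_sa_bot.
Qed.
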